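(* Let $\mathcal{G}$ be a finite-dimensional Lie algebra over a field $\mathbb{F}$ of characteristic zero which admits an associative Novikov structure, i.e. a bilinear product $\cdot$ on $\mathcal{G}$ such that $[x,y]=x\cdot y-y\cdot x$, $(x\cdot y)\cdot z=x\cdot(y\cdot z)$ and $(x\cdot y)\cdot z=(x\cdot z)\cdot y$ for all $x,y,z\in\mathcal{G}$. Then $\mathcal{G}$ is $2$-step solvable.
   Context: A Lie algebra $\mathcal{G}$ is called $2$-step solvable here if its derived ideal $[\mathcal{G},\mathcal{G}]$ is abelian. *)

(* Defs.v *)
From HB Require Import structures.
From mathcomp Require Import all_boot all_order all_algebra.

Set Implicit Arguments.
Unset Strict Implicit.
Unset Printing Implicit Defensive.

Import GRing.Theory.
Local Open Scope ring_scope.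

HB.mixin Record Lmodule_isLie (F : fieldType) (G : Type)
    of GRing.Lmodule F G := {
  lie : {bilinear G -> G -> G};
  liexx : forall x : G, lie x x = 0;
  lie_jacobi : forall x y z : G,
    lie x (lie y z) + lie y (lie z x) + lie z (lie x y) = 0
}.

#[short(type="lieAlgType")]
HB.structure Definition LieAlgebra (F : fieldType) :=
  {G of Lmodule_isLie F G & GRing.Lmodule F G}.

#[short(type="finDimLieAlgType")]
HB.structure Definition FinDimLieAlgebra (F : fieldType) :=
  {G of LieAlgebra F G & Vector F G}.

Notation "'[ x , y ]" := (lie x y) (format "''[' x ,  y ]") : ring_scope.

(* Membership in the derived ideal [G, G], the linear span of all brackets. *)
Definition derived_ideal (F : fieldType) (G : lieAlgType F) (u : G) : Prop :=
  exists s : seq (F * (G * G)),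
    u = \sum_(p <- s) p.1 *: '[p.2.1, p.2.2].

Definition abelian_on (F : fieldType) (G : lieAlgType F) (S : G -> Prop) :
    Prop :=
  forall u v : G, S u -> S v -> '[u, v] = 0.

(* Metabelian; the abelian case is included. *)
Definition two_step_solvable (F : fieldType) (G : lieAlgType F) : Prop :=
  abelian_on (@derived_ideal F G).

(* The left-symmetry axiom of a Novikov structure is automatic here, since the
   product is associative and its commutator is the bracket. *)
Record assoc_novikov (F : fieldType) (G : lieAlgType F)
    (m : {bilinear G -> G -> G}) : Prop := AssocNovikov {
  novikov_lie : forall x y : G, '[x, y] = m x y - m y x;
  novikov_assoc : forall x y z : G, m (m x y) z = m x (m y z);
  novikov_right_comm : forall x y z : G, m (m x y) z = m (m x z) y
}.

(* Main.v *)
Require Import Defs.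
From HB Require Import structures.
From mathcomp Require Import all_boot all_order all_algebra.
Import GRing.Theory.
Local Open Scope ring_scope.

(** In a triple product the last two factors commute, whichever way it is bracketed. Hence a left
    multiplication cannot distinguish [m y z] from [m z y]: it kills each commutator and, being
    linear, their whole span. *)

Lemma assoc_novikov_mul_derived (F : fieldType) (G : lieAlgType F)
    (m : {bilinear G -> G -> G}) (x u : G) :
  assoc_novikov m -> derived_ideal u -> m x u = 0.
Proof.
move=> mN [s ->]; rewrite linear_sumr big1 // => -[a [y z]] _ /=.
rewrite linearZr_LR (novikov_lie mN) linearBr.
(* With both products bracketed to the left, a single swap of the last two factors makes the two
   terms of the difference equal. *)
by rewrite -!(novikov_assoc mN) (novikov_right_comm mN) subrr scaler0.
Qed.

(* Since x(yz) = (xy)z = (xz)y = x(zy), every left multiplication kills [G, G],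
   so both terms of [u, v] = uv - vu vanish on the derived ideal. *)
Theorem corollary9 (F : fieldType) (charF0 : [pchar F] =i pred0)
    (G : finDimLieAlgType F)
    (admits : exists m : {bilinear G -> G -> G}, assoc_novikov m) :
  two_step_solvable G.
Proof.
case: admits => m mN u v Du Dv.
by rewrite (novikov_lie mN) !(assoc_novikov_mul_derived _ _ _ _ _ mN) // subrr.
Qed.
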